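(* Let $L$ be a weakly dicomplemented lattice. The lattice $NI(L)$ of normal ideals of $L$ is isomorphic to the lattice $NF(L)$ of normal filters of $L$, via the map $\Psi:NI(L)\to NF(L)$, $\Psi(J)=\{z\in L\mid z\ge x^{\Delta}\text{ for some }x\in J\}$, whose inverse is the map $\Phi:NF(L)\to NI(L)$, $\Phi(F)=\{z\in L\mid z\le x^{\nabla}\text{ for some }x\in F\}$.
   Context: A weakly dicomplemented lattice (WDL) is an algebra $(L;\wedge,\vee,{}^{\Delta},{}^{\nabla},0,1)$ of type $(2,2,1,1,0,0)$ such that $(L;\wedge,\vee,0,1)$ is a bounded lattice and for all $x,y\in L$: $x^{\Delta\Delta}\le x$; $x\le y\Rightarrow y^{\Delta}\le x^{\Delta}$; $(x\wedge y)\vee(x\wedge y^{\Delta})=x$; $x^{\nabla\nabla}\ge x$; $x\le y\Rightarrow y^{\nabla}\le x^{\nabla}$; $(x\vee y)\wedge(x\vee y^{\nabla})=x$. Exponents are applied from left to right: $x^{\Delta\nabla}=(x^{\Delta})^{\nabla}$, $x^{\nabla\Delta}=(x^{\nabla})^{\Delta}$. A filter of $L$ is a nonempty upward closed subset closed under $\wedge$; an ideal is defined dually ($L$ itself is allowed). A filter $F$ is normal if $x\in F$ implies $x^{\Delta\nabla}\in F$; an ideal $I$ is normal if $x\in I$ implies $x^{\nabla\Delta}\in I$. $NF(L)$ and $NI(L)$ are the sets of normal filters and normal ideals, each ordered by inclusion (and each a complete lattice). *)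

(* Defs.v *)
From HB Require Import structures.
From mathcomp Require Import all_boot all_order.
From mathcomp Require Import boolp classical_sets.

Set Implicit Arguments.
Unset Strict Implicit.
Unset Printing Implicit Defensive.

Import Order.Theory.
Local Open Scope classical_set_scope.
Local Open Scope order_scope.

HB.mixin Record isWeaklyDicomplemented d L of Order.TBLattice d L := {
  wdelta : L -> L;
  wnabla : L -> L;
  wdeltaK_le : forall x : L, wdelta (wdelta x) <= x;
  wdelta_anti : forall x y : L, x <= y -> wdelta y <= wdelta x;
  wdelta_meet : forall x y : L, (x `&` y) `|` (x `&` wdelta y) = x;
  wnablaK_ge : forall x : L, x <= wnabla (wnabla x);
  wnabla_anti : forall x y : L, x <= y -> wnabla y <= wnabla x;
  wnabla_join : forall x y : L, (x `|` y) `&` (x `|` wnabla y) = x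
}.

#[short(type="wdlType")]
HB.structure Definition WDL d :=
  {L of isWeaklyDicomplemented d L & Order.TBLattice d L}.

(* The postfix exponents apply from left to right: x^Δ^∇ is (x^Δ)^∇. *)
Notation "x ^Δ" := (wdelta x) (at level 1, left associativity, format "x ^Δ").
Notation "x ^∇" := (wnabla x) (at level 1, left associativity, format "x ^∇").

Section NormalSubsets.
Context (d : Order.disp_t) (L : wdlType d).
Implicit Types (A F G I J : set L) (x y : L).

Definition is_filter F :=
  [/\ F !=set0, forall x y, F x -> x <= y -> F y
    & forall x y, F x -> F y -> F (x `&` y)].

Definition is_ideal I :=
  [/\ I !=set0, forall x y, I x -> y <= x -> I y
    & forall x y, I x -> I y -> I (x `|` y)].

Definition is_normal_filter F := is_filter F /\ forall x, F x -> F x^Δ^∇.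

Definition is_normal_ideal I := is_ideal I /\ forall x, I x -> I x^∇^Δ.

Lemma filter_top F : is_filter F -> F \top.
Proof. by case=> -[x Fx] Fup _; exact: Fup Fx (lex1 x). Qed.

Lemma ideal_bottom I : is_ideal I -> I \bot.
Proof. by case=> -[x Ix] Idn _; exact: Idn Ix (le0x x). Qed.

Lemma is_normal_filter_bigcap (C : set (set L)) :
  (forall F, C F -> is_normal_filter F) ->
  is_normal_filter (\bigcap_(F in C) F).
Proof.
move=> CN; split; first split.
- by exists \top => F /CN[/filter_top].
- by move=> x y xC xy F CF; have [[_ + _] _] := CN _ CF; apply; first exact: xC.
- move=> x y xC yC F CF; have [[_ _ +] _] := CN _ CF.
  by apply; [exact: xC | exact: yC].
- by move=> x xC F CF; have [_] := CN _ CF; apply; exact: xC.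
Qed.

Lemma is_normal_ideal_bigcap (C : set (set L)) :
  (forall I, C I -> is_normal_ideal I) ->
  is_normal_ideal (\bigcap_(I in C) I).
Proof.
move=> CN; split; first split.
- by exists \bot => I /CN[/ideal_bottom].
- by move=> x y xC xy I CI; have [[_ + _] _] := CN _ CI; apply; first exact: xC.
- move=> x y xC yC I CI; have [[_ _ +] _] := CN _ CI.
  by apply; [exact: xC | exact: yC].
- by move=> x xC I CI; have [_] := CN _ CI; apply; exact: xC.
Qed.

Lemma is_normal_filterI F G :
  is_normal_filter F -> is_normal_filter G ->
  is_normal_filter (F `&` G)%classic.
Proof.
move=> NF NG; rewrite -(bigcap_set1 id F) -(bigcap_set1 id G) -bigcap_setU.
by apply: is_normal_filter_bigcap => H [->|->].
Qed.

Lemma is_normal_idealI I J :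
  is_normal_ideal I -> is_normal_ideal J ->
  is_normal_ideal (I `&` J)%classic.
Proof.
move=> NI NJ; rewrite -(bigcap_set1 id I) -(bigcap_set1 id J) -bigcap_setU.
by apply: is_normal_ideal_bigcap => H [->|->].
Qed.

Lemma is_normal_filter_smallest A :
  is_normal_filter (smallest is_normal_filter A).
Proof. by apply: is_normal_filter_bigcap => F []. Qed.

Lemma is_normal_ideal_smallest A :
  is_normal_ideal (smallest is_normal_ideal A).
Proof. by apply: is_normal_ideal_bigcap => I []. Qed.

Definition psi_set I : set L := [set z | exists2 x, I x & x^Δ <= z].

Definition phi_set F : set L := [set z | exists2 x, F x & z <= x^∇].

End NormalSubsets.

Record normal_filter d (L : wdlType d) := NormalFilter {
  nf_set :> set L;
  _ : `[< is_normal_filter nf_set >]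
}.

Record normal_ideal d (L : wdlType d) := NormalIdeal {
  ni_set :> set L;
  _ : `[< is_normal_ideal ni_set >]
}.

(* As subtypes of [set L], whose canonical order is inclusion, both types are
   ordered by inclusion. *)
HB.instance Definition _ d (L : wdlType d) := [isSub for @nf_set d L].
HB.instance Definition _ d (L : wdlType d) :=
  [Choice of normal_filter L by <:].
HB.instance Definition _ d (L : wdlType d) :=
  [SubChoice_isSubPOrder of normal_filter L by <: with set_display].

HB.instance Definition _ d (L : wdlType d) := [isSub for @ni_set d L].
HB.instance Definition _ d (L : wdlType d) :=
  [Choice of normal_ideal L by <:].
HB.instance Definition _ d (L : wdlType d) :=
  [SubChoice_isSubPOrder of normal_ideal L by <: with set_display].

Section Lattices.
Context (d : Order.disp_t) (L : wdlType d).
Implicit Types (F G H : normal_filter L) (I J K : normal_ideal L).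

Lemma normal_filterP F : is_normal_filter F.
Proof. by case: F => F /= /asboolP. Qed.

Lemma normal_idealP I : is_normal_ideal I.
Proof. by case: I => I /= /asboolP. Qed.

Lemma le_normal_filterP F G : reflect (nf_set F `<=` nf_set G) (F <= G).
Proof. exact: subsetPset. Qed.

Lemma le_normal_idealP I J : reflect (ni_set I `<=` ni_set J) (I <= J).
Proof. exact: subsetPset. Qed.

Definition nf_meet F G : normal_filter L :=
  NormalFilter (asboolT (is_normal_filterI (normal_filterP F)
                                           (normal_filterP G))).

Definition nf_join F G : normal_filter L :=
  NormalFilter (asboolT (is_normal_filter_smallest
                           (nf_set F `|` nf_set G)%classic)).

Definition ni_meet I J : normal_ideal L :=
  NormalIdeal (asboolT (is_normal_idealI (normal_idealP I) (normal_idealP J))).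

Definition ni_join I J : normal_ideal L :=
  NormalIdeal (asboolT (is_normal_ideal_smallest
                          (ni_set I `|` ni_set J)%classic)).

Fact nf_meetP F G H : (F <= nf_meet G H) = (F <= G) && (F <= H).
Proof.
apply/le_normal_filterP/andP => [FGH|].
  by split; apply/le_normal_filterP => x /FGH[].
by case=> /le_normal_filterP FG /le_normal_filterP FH x Fx; split; auto.
Qed.

Fact nf_joinP F G H : (nf_join F G <= H) = (F <= H) && (G <= H).
Proof.
apply/le_normal_filterP/andP => [FGH|].
  move: (subset_trans (@sub_gen_smallest _ _ _) FGH).
  by rewrite subUset => -[? ?]; split; exact/le_normal_filterP.
case=> /le_normal_filterP FH /le_normal_filterP GH.
apply: smallest_sub; first exact: normal_filterP.
by rewrite subUset; split.
Qed.

Fact ni_meetP I J K : (I <= ni_meet J K) = (I <= J) && (I <= K).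
Proof.
apply/le_normal_idealP/andP => [IJK|].
  by split; apply/le_normal_idealP => x /IJK[].
by case=> /le_normal_idealP IJ /le_normal_idealP IK x Ix; split; auto.
Qed.

Fact ni_joinP I J K : (ni_join I J <= K) = (I <= K) && (J <= K).
Proof.
apply/le_normal_idealP/andP => [IJK|].
  move: (subset_trans (@sub_gen_smallest _ _ _) IJK).
  by rewrite subUset => -[? ?]; split; exact/le_normal_idealP.
case=> /le_normal_idealP IK /le_normal_idealP JK.
apply: smallest_sub; first exact: normal_idealP.
by rewrite subUset; split.
Qed.

End Lattices.

HB.instance Definition _ d (L : wdlType d) :=
  Order.POrder_MeetJoin_isLattice.Build set_display (normal_filter L)
    (@nf_meetP d L) (@nf_joinP d L).

HB.instance Definition _ d (L : wdlType d) :=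
  Order.POrder_MeetJoin_isLattice.Build set_display (normal_ideal L)
    (@ni_meetP d L) (@ni_joinP d L).

(* Main.v *)
Require Import Defs.
From HB Require Import structures.
From mathcomp Require Import all_boot all_order.
From mathcomp Require Import boolp classical_sets.

(** In a weakly dicomplemented lattice x^∇ <= x^Δ, because x^∇ is disjoint from x
    while x^Δ joins with x to the top ([nabla_le_delta]).

    For a down-set J, the set Psi(J) is the preimage of J under Δ
    ([psi_setE]): if z >= x^Δ with x in J, then z^Δ <= x^ΔΔ <= x, and conversely
    z >= z^ΔΔ makes z^Δ itself a witness.  Dually, for an up-set F, Phi(F) is the
    preimage of F under ∇ ([phi_setE]).  Hence normality of Psi(J) is the
    normality of J at the elements z^Δ, and Phi(Psi(J)) is the set of the z such
    that z^∇Δ lies in J.  This set contains J because J is normal, and is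
    contained in J because z <= z^∇∇ <= z^∇Δ; the composite in the other order is
    treated dually.  Both maps are monotone by definition, so they are mutually
    inverse order isomorphisms, and an order isomorphism between lattices
    preserves meets and joins ([can_homo_meet], [can_homo_join]). *)

Section OrderIsomorphism.
Import Order.Theory.
Local Open Scope order_scope.
Context {d d' : Order.disp_t} {T : latticeType d} {T' : latticeType d'}.
Context {f : T -> T'} {g : T' -> T}.
Hypotheses (fK : cancel f g) (gK : cancel g f).
Hypotheses (f_homo : {homo f : x y / x <= y}) (g_homo : {homo g : x y / x <= y}).

Let le_can x z : (z <= f x) = (g z <= x).
Proof. by apply/idP/idP => [/g_homo|/f_homo]; rewrite ?fK ?gK. Qed.

Let can_le x z : (f x <= z) = (x <= g z).
Proof. by apply/idP/idP => [/g_homo|/f_homo]; rewrite ?fK ?gK. Qed.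

Lemma can_homo_meet : {morph f : x y / x `&` y}.
Proof.
move=> x y; apply/le_anti.
by rewrite lexI !f_homo ?leIl ?leIr //= le_can lexI -!le_can leIl leIr.
Qed.

Lemma can_homo_join : {morph f : x y / x `|` y}.
Proof.
move=> x y; apply/le_anti.
by rewrite leUx !f_homo ?leUl ?leUr // andbT can_le leUx -!can_le leUl leUr.
Qed.

End OrderIsomorphism.

Section NormalCorrespondence.
Import Order.Theory.
Local Open Scope classical_set_scope.
Local Open Scope order_scope.
Context {d : Order.disp_t} {L : wdlType d}.
Implicit Types (F J : set L) (x y z : L).

Lemma joinx_delta x : x `|` x^Δ = \top.
Proof. by have := wdelta_meet \top x; rewrite !meet1x. Qed.

Lemma meetx_nabla x : x `&` x^∇ = \bot.
Proof. by have := wnabla_join \bot x; rewrite !join0x. Qed.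

(** The law for Δ splits x^∇ along x, and its part below x vanishes. *)
Lemma nabla_le_delta x : x^∇ <= x^Δ.
Proof.
have := wdelta_meet x^∇ x; rewrite [x^∇ `&` x]meetC meetx_nabla join0x => <-.
exact: leIr.
Qed.

(** Identifies Psi(J) with a preimage, which turns the statements about witnesses
    into membership statements. *)
Lemma psi_setE {J} z : is_ideal J -> psi_set J z <-> J z^Δ.
Proof.
case=> _ J_down _; split=> [[x Jx /wdelta_anti le_zx]|Jz].
  exact: J_down Jx (le_trans le_zx (wdeltaK_le x)).
by exists z^Δ => //; apply: wdeltaK_le.
Qed.

Lemma phi_setE {F} z : is_filter F -> phi_set F z <-> F z^∇.
Proof.
case=> _ F_up _; split=> [[x Fx /wnabla_anti le_xz]|Fz].
  exact: F_up Fx (le_trans (wnablaK_ge x) le_xz).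
by exists z^∇ => //; apply: wnablaK_ge.
Qed.

Lemma psi_set_normal {J} : is_normal_ideal J -> is_normal_filter (psi_set J).
Proof.
case=> J_ideal J_normal; have [_ _ J_join] := J_ideal.
split; first split.
- by exists \bot^Δ, \bot; [exact: ideal_bottom|].
- by move=> x y [w Jw le_wx] le_xy; exists w; last exact: le_trans le_xy.
- move=> x y [v Jv le_vx] [w Jw le_wy]; exists (v `|` w); first exact: J_join.
  rewrite lexI (le_trans _ le_vx) ?(le_trans _ le_wy) //; apply: wdelta_anti.
    exact: leUr.
  exact: leUl.
- by move=> z /(psi_setE z J_ideal) Jz; apply/(psi_setE _ J_ideal)/J_normal.
Qed.

Lemma phi_set_normal {F} : is_normal_filter F -> is_normal_ideal (phi_set F).
Proof.
case=> F_filter F_normal; have [_ _ F_meet] := F_filter.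
split; first split.
- by exists \top^∇, \top; [exact: filter_top|].
- by move=> x y [w Fw le_xw] le_yx; exists w; last exact: le_trans le_xw.
- move=> x y [v Fv le_xv] [w Fw le_yw]; exists (v `&` w); first exact: F_meet.
  rewrite leUx (le_trans le_xv) ?(le_trans le_yw) //; apply: wnabla_anti.
    exact: leIr.
  exact: leIl.
- by move=> z /(phi_setE z F_filter) Fz; apply/(phi_setE _ F_filter)/F_normal.
Qed.

(** The composite is the set of the z with z^∇Δ in J, and z <= z^∇Δ. *)
Lemma psi_setK {J} : is_normal_ideal J -> phi_set (psi_set J) = J.
Proof.
move=> NJ; have [J_ideal J_normal] := NJ; have [_ J_down _] := J_ideal.
have [psi_filter _] := psi_set_normal NJ.
apply/seteqP; split=> z.
  move=> /(phi_setE z psi_filter)/(psi_setE _ J_ideal) Jz.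
  exact: J_down Jz (le_trans (wnablaK_ge z) (nabla_le_delta _)).
by move=> /J_normal Jz; apply/(phi_setE z psi_filter)/(psi_setE _ J_ideal).
Qed.

Lemma phi_setK {F} : is_normal_filter F -> psi_set (phi_set F) = F.
Proof.
move=> NF; have [F_filter F_normal] := NF; have [_ F_up _] := F_filter.
have [phi_ideal _] := phi_set_normal NF.
apply/seteqP; split=> z.
  move=> /(psi_setE z phi_ideal)/(phi_setE _ F_filter) Fz.
  exact: F_up Fz (le_trans (nabla_le_delta _) (wdeltaK_le z)).
by move=> /F_normal Fz; apply/(psi_setE z phi_ideal)/(phi_setE _ F_filter).
Qed.

Definition psi (J : normal_ideal L) : normal_filter L :=
  NormalFilter (asboolT (psi_set_normal (normal_idealP J))).

Definition phi (F : normal_filter L) : normal_ideal L :=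
  NormalIdeal (asboolT (phi_set_normal (normal_filterP F))).

Lemma psiK : cancel psi phi.
Proof. by move=> J; apply/val_inj/psi_setK/normal_idealP. Qed.

Lemma phiK : cancel phi psi.
Proof. by move=> F; apply/val_inj/phi_setK/normal_filterP. Qed.

Lemma psi_homo : {homo psi : J K / J <= K}.
Proof.
move=> J K /le_normal_idealP sJK; apply/le_normal_filterP.
by move=> z [x /sJK Kx le_xz]; exists x.
Qed.

Lemma phi_homo : {homo phi : F G / F <= G}.
Proof.
move=> F G /le_normal_filterP sFG; apply/le_normal_idealP.
by move=> z [x /sFG Gx le_zx]; exists x.
Qed.

HB.instance Definition _ :=
  Order.isOrderMorphism.Build _ _ _ _ psi psi_homo.
HB.instance Definition _ :=
  Order.isLatticeMorphism.Build _ _ _ _ psi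
    (can_homo_meet psiK phiK psi_homo phi_homo)
    (can_homo_join psiK phiK psi_homo phi_homo).

End NormalCorrespondence.

Theorem theorem8 (d : Order.disp_t) (L : wdlType d) :
  exists (Psi : {lmorphism normal_ideal L -> normal_filter L})
         (Phi : normal_filter L -> normal_ideal L),
    [/\ forall J : normal_ideal L, nf_set (Psi J) = psi_set J,
        forall F : normal_filter L, ni_set (Phi F) = phi_set F,
        cancel Psi Phi & cancel Phi Psi].
Proof. by exists psi, phi; split=> //; [exact: psiK | exact: phiK]. Qed.
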